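(* Let $l,k,E,I>0$ be real constants, and let $\mathcal{K}_l$ be the associated integral operator on $L^2[-l,l]$, $\mathcal{K}_l[u](x)=\int_{-l}^{l}K(|x-\xi|)\,u(\xi)\,d\xi$. Then $\mathcal{K}_l$ has no nontrivial eigenvalues outside the open interval $(0,1/k)$; that is, every eigenvalue $\lambda\neq 0$ of $\mathcal{K}_l$ is real and satisfies $0<\lambda<1/k$.
   Context: $L^2[-l,l]$ is the Hilbert space of square-integrable complex-valued functions on $[-l,l]$. Put $\alpha=\sqrt[4]{k/(EI)}>0$. The kernel function is $$K(y)=\frac{\alpha}{2k}\exp\left(-\frac{\alpha}{\sqrt2}\,y\right)\sin\left(\frac{\alpha}{\sqrt2}\,y+\frac{\pi}{4}\right),\qquad y\ge 0.$$ The value $0$ is called the trivial eigenvalue; ''nontrivial eigenvalue'' means nonzero eigenvalue. *)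

(* Defs.v *)
From HB Require Import structures.
From mathcomp Require Import all_boot all_order all_algebra.
From mathcomp Require Import complex.
From mathcomp Require Import all_classical all_reals all_analysis.

Set Implicit Arguments.
Unset Strict Implicit.
Unset Printing Implicit Defensive.

Import Order.TTheory GRing.Theory Num.Theory.

Local Open Scope classical_set_scope.
Local Open Scope ring_scope.
Local Open Scope complex_scope.

Section BeamOperator.
Context {R : realType}.

Local Notation mu := (@lebesgue_measure R).

Definition alpha (k E I : R) : R := (k / (E * I)) `^ (4^-1).

Definition kernel_fun (k E I y : R) : R :=
  alpha k E I / (2 * k)
    * expR (- (alpha k E I / Num.sqrt 2 * y))
    * sin (alpha k E I / Num.sqrt 2 * y + pi / 4).

(* The library integrates real- and extended-real-valued functions only, so
   measurability and integration of R[i]-valued functions are taken on real and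
   imaginary parts. *)
Definition cmeasurable_fun (D : set R) (f : R -> R[i]) : Prop :=
  measurable_fun D (fun x => complex.Re (f x)) /\
  measurable_fun D (fun x => complex.Im (f x)).

Definition cintegral (D : set R) (f : R -> R[i]) : R[i] :=
  Rintegral mu D (fun x => complex.Re (f x)) +i*
  Rintegral mu D (fun x => complex.Im (f x)).

(* [L2 D] presents the Hilbert space L^2(D) by representatives: its vectors are
   the square-integrable functions, two of which are the same vector when they
   agree almost everywhere on D. Representatives are Borel measurable; every
   Lebesgue measurable function agrees a.e. with such a one.
   [normc] is the complex modulus with values in R. *)
Definition L2 (D : set R) (f : R -> R[i]) : Prop :=
  cmeasurable_fun D f /\
  mu.-integrable D (fun x => (ComplexField.Normc.normc (f x) ^+ 2)%:E).

Definition is_eigenvalue (D : set R) (T : (R -> R[i]) -> (R -> R[i]))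
    (lam : R[i]) : Prop :=
  exists u : R -> R[i],
    [/\ L2 D u, ~ (u = (fun=> 0) %[ae mu in D])
      & T u = (fun x => lam * u x) %[ae mu in D]].

Definition Kop (l k E I : R) (u : R -> R[i]) : R -> R[i] := fun x =>
  cintegral `[- l, l] (fun xi => (kernel_fun k E I `|x - xi|)%:C * u xi).

End BeamOperator.

(* Main.v *)
Require Import Defs.
From HB Require Import structures.
From mathcomp Require Import all_boot all_order all_algebra.
From mathcomp Require Import complex.
From mathcomp Require Import all_classical all_reals all_analysis.
From mathcomp Require Import measurable_realfun.
From mathcomp Require Import ring lra.

Import Order.TTheory GRing.Theory Num.Theory.
Import numFieldNormedType.Exports.

Local Open Scope classical_set_scope.
Local Open Scope ring_scope.

(** Put [a = alpha / sqrt 2], so that [4 a^4 = k / (E I)].  The kernel is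
    [a / (2 k)] times [exp (- a y) (cos (a y) + sin (a y))], and
    [w = x |-> int_(-l)^l K(|x - t|) f(t) dt] is the restriction to [[-l, l]]
    of the decaying solution on the whole line of
    [w'''' + 4 a^4 w = (4 a^4 / k) f], where [f] is extended by zero.  Outside
    [[-l, l]] that solution is a combination of two decaying exponentials,
    which amounts to two linear boundary conditions at each end point.

    Everything follows from integrating by parts against this boundary value
    problem.  For two solutions [w] and [z] consider the Green form
    [w''' z - w'' z'].
    - The boundary conditions make it symmetric at both end points, positive
      semi-definite at [l] and negative semi-definite at [-l].
    - Its derivative is [(4 a^4 / k) f z - 4 a^4 w z - w'' z''].

    Let [lam = s + i t] be a nonzero eigenvalue.  An eigenfunction equals almost
    everywhere the continuous function [v / lam], where [v] is its image, and
    [v = f + i g] satisfies the eigenvalue equation at every point.  With [w]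
    and [z] the images of [f] and [g]:
    - the antisymmetric part of the Green form vanishes at both ends, and its
      derivative is a positive multiple of [t |v|^2]; hence [t = 0];
    - the sum of the two diagonal Green forms has derivative
      [C (s - k |lam|^2) |v|^2 - w''^2 - z''^2] with [C > 0], but does not
      decrease from [-l] to [l].  If [s <= k |lam|^2] it must be constant, so
      [w'' = z'' = 0] and the boundary values of [w], [w'], [z], [z'] vanish,
      which forces [v = 0].  Hence [k s^2 < s], that is [0 < s < 1 / k].

    Instead of integrating the derivative of the Green form, its sign is used
    through monotonicity ([nonincreasing_eq_ends_derivative0]).  The link between
    the kernel and the differential equation is [exists_beam_jet], and the
    spectral argument is [jet_eigenvalue]. *)

Section BeamSpectrum.
Context {R : realType}.
Local Notation mu := (@lebesgue_measure R).
Implicit Types (f g h F : R -> R) (a b l x y : R).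

Set Implicit Arguments.
Unset Strict Implicit.

(** * Derivatives and antiderivatives on a segment *)

Lemma is_derive_continuous F x (d : R) :
  is_derive x 1 F d -> {for x, continuous F}.
Proof.
by move=> [dF _]; exact/differentiable_continuous/derivable1_diffP.
Qed.

Lemma is_derive_within_continuous F f a b :
  (forall x, a <= x <= b -> is_derive x 1 F (f x)) ->
  {within `[a, b], continuous F}.
Proof.
by move=> dF; apply: derivable_within_continuous => x /[!in_itv]/= /dF[].
Qed.

(** The rules below restate the calculus of derivatives for explicit lambda
    abstractions, so that derivatives can be assembled as terms. *)
Lemma is_derive_addf f g x (df dg : R) : is_derive x 1 f df ->
  is_derive x 1 g dg -> is_derive x 1 (fun t => f t + g t) (df + dg).
Proof. by move=> ? ?; exact: is_deriveD. Qed.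

Lemma is_derive_subf f g x (df dg : R) : is_derive x 1 f df ->
  is_derive x 1 g dg -> is_derive x 1 (fun t => f t - g t) (df - dg).
Proof. by move=> ? ?; exact: is_deriveB. Qed.

Lemma is_derive_mulf f g x (df dg : R) : is_derive x 1 f df ->
  is_derive x 1 g dg ->
  is_derive x 1 (fun t => f t * g t) (df * g x + f x * dg).
Proof.
by move=> dF dG; rewrite addrC [df * _]mulrC; exact: (is_deriveM dF dG).
Qed.

Lemma is_derive_cmulf b f x (df : R) : is_derive x 1 f df ->
  is_derive x 1 (fun t => b * f t) (b * df).
Proof. by move=> dF; exact: (is_deriveZ b dF). Qed.

Lemma is_derive_comp_mull b F x (dF : R) : is_derive (b * x) 1 F dF ->
  is_derive x 1 (fun t => F (b * t)) (b * dF).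
Proof.
move=> dFx; rewrite mulrC.
apply: (@is_derive1_comp _ F (fun t => b * t)).
by rewrite -[X in is_derive _ _ _ X]mulr1; exact: is_derive_cmulf.
Qed.

Lemma continuous_integrable_itv f a b : continuous f ->
  mu.-integrable `[a, b] (EFin \o f).
Proof.
move=> cf; apply: continuous_compact_integrable; first exact: segment_compact.
exact: continuous_subspaceT.
Qed.

Lemma Rintegral_FTC2 f F a b : a <= b -> continuous f ->
  (forall x, a <= x <= b -> is_derive x 1 F (f x)) ->
  \int[mu]_(x in `[a, b]) f x = F b - F a.
Proof.
rewrite le_eqVlt => /predU1P[->|ab] cf dF.
  by rewrite subrr set_itv1 Rintegral_set1.
rewrite /Rintegral (@continuous_FTC2 _ f F) //.
- exact: continuous_subspaceT.
- split.
  + by move=> x /[!in_itv]/= /andP[ax xb]; have [] := dF x; rewrite ?ltW.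
  + apply: cvg_at_right_filter.
    by apply: is_derive_continuous; apply: dF; rewrite lexx ltW.
  + apply: cvg_at_left_filter.
    by apply: is_derive_continuous; apply: dF; rewrite lexx ltW.
- move=> x /[!in_itv]/= /andP[ax xb]; rewrite derive1E.
  by apply: derive_val; apply: dF; rewrite !ltW.
Qed.

(** Starting the integral at [a], strictly to the left of the points of
    interest, makes the antiderivative differentiable in the two-sided sense
    at the end points of any segment contained in the open half-line. *)
Lemma exists_antiderivative f a x0 : continuous f ->
  exists F, F x0 = 0 /\ forall x, a < x -> is_derive x 1 F (f x).
Proof.
move=> cf.
pose F x := \int[mu]_(t in `[a, x]) f t.
exists (fun x => F x - F x0); split; first by rewrite subrr.
move=> x ax.
have xx1 : x < x + 1 by rewrite ltrDl.
have [dF F'] :=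
  continuous_FTC1_closed xx1 (continuous_integrable_itv a (x + 1) cf) ax (cf x).
have {F'}dF : is_derive x 1 F (f x).
  by split; [exact: dF|rewrite -derive1E F'].
by rewrite -[f x]subr0; exact: is_deriveB.
Qed.

Lemma Rintegral_split f a b x : a <= x <= b -> continuous f ->
  \int[mu]_(t in `[a, b]) f t =
  \int[mu]_(t in `[a, x]) f t + \int[mu]_(t in `[x, b]) f t.
Proof.
move=> /andP[ax xb] cf.
have intf := continuous_integrable_itv a b cf.
have intf' : mu.-integrable `]x, b] (EFin \o f).
  by apply: integrableS intf => //; apply: subset_itvr; rewrite bnd_simp.
rewrite -(Rintegral_itv_obnd_cbnd intf').
by rewrite -(Rintegral_itvB intf) ?bnd_simp// addrC subrK.
Qed.

Lemma derivative_eq0_constant F f a b :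
  (forall x, a <= x <= b -> is_derive x 1 F (f x)) ->
  (forall x, a < x < b -> f x = 0) ->
  forall x, a <= x <= b -> F x = F b.
Proof.
move=> dF f0 x /andP[ax xb].
have [||z _] := @MVT_segment _ F (cst 0) x b xb.
- move=> y /[!in_itv]/= /andP[xy yb].
  rewrite /= -[in X in is_derive _ _ _ X](f0 y).
    by apply: dF; rewrite (le_trans ax) ?ltW.
  by rewrite (le_lt_trans ax).
- apply: is_derive_within_continuous => y /andP[xy yb].
  by apply: dF; rewrite (le_trans ax).
by rewrite mul0r => /eqP; rewrite subr_eq0 => /eqP.
Qed.

(** A nonincreasing function that does not decrease between the end points is
    constant.  This replaces integrating [f] and using that a continuous
    function of constant sign with zero integral vanishes. *)
Lemma nonincreasing_eq_ends_derivative0 F f a b :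
  (forall x, a <= x <= b -> is_derive x 1 F (f x)) ->
  (forall x, a <= x <= b -> f x <= 0) ->
  F a <= F b -> forall x, a < x < b -> f x = 0.
Proof.
move=> dF f0 Fab x /andP[ax xb].
have ab : a <= b by rewrite ltW// (lt_trans ax).
have mono y z : a <= y -> y <= z -> z <= b -> F z <= F y.
  move=> ay yz zb; apply: (@ler0_derive1_le_cc _ F a b) => //.
  - by move=> t /[!in_itv]/= /andP[? ?]; have [] := dF t; rewrite ?ltW.
  - move=> t /[!in_itv]/= /andP[? ?]; rewrite derive1E.
    have -> : 'D_1 F t = f t by apply: derive_val; apply: dF; rewrite !ltW.
    by rewrite f0// !ltW.
  - exact: is_derive_within_continuous dF.
  - by rewrite in_itv/= zb (le_trans ay).
  - by rewrite in_itv/= ay (le_trans yz).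
have Fc y : a <= y <= b -> F y = F b.
  move=> /andP[ay yb]; apply/eqP; rewrite eq_le (mono y b)// andbT.
  by rewrite (le_trans _ Fab)// mono.
have dFx : is_derive x 1 F (f x) by apply: dF; rewrite !ltW.
have : is_derive x 1 F (0 : R).
  apply: (@near_eq_is_derive _ _ _ (cst (F b))).
  near=> y; apply/esym/Fc.
  by apply/andP; split; apply: ltW; near: y; [exact: lt_nbhsr|exact: lt_nbhsl].
by move=> [_ <-]; rewrite derive_val.
Unshelve. all: by end_near. Qed.

(** * Convolution with a bounded continuous kernel *)

Lemma continuous_kernel_translate (kappa : R -> R) x : continuous kappa ->
  continuous (fun t : R => kappa `|x - t|).
Proof.
move=> ck t.
apply: (@continuous_comp _ _ _ (fun t => `|x - t|) kappa); last exact: ck.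
by apply: cvg_norm; apply: cvgB; [exact: cvg_cst|exact: cvg_id].
Qed.

Lemma integrable_convolution (kappa : R -> R) (M : R) (D : set R) f x :
  continuous kappa -> (forall y, 0 <= y -> `|kappa y| <= M) ->
  measurable D -> mu.-integrable D (EFin \o f) ->
  mu.-integrable D (EFin \o (fun t => kappa `|x - t| * f t)).
Proof.
move=> ck kM mD intf.
have mf := measurable_int _ intf.
apply: (@le_integrable _ _ _ mu D mD _ (fun t => M%:E * (f t)%:E)%E).
- apply/measurable_EFinP; apply: measurable_funM; last exact/measurable_EFinP.
  apply: measurable_funTS; apply: continuous_measurable_fun.
  exact: continuous_kernel_translate.
- move=> t _; rewrite /= lee_fin !normrM ler_wpM2r//.
  by rewrite (le_trans (kM _ _))// ler_norm.
- exact: integrableZl.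
Qed.

(** Convolution smooths: this turns an eigenfunction, known only almost
    everywhere, into a continuous one. *)
Lemma continuous_convolution (kappa : R -> R) (M : R) (D : set R) f :
  continuous kappa -> (forall y, 0 <= y -> `|kappa y| <= M) ->
  measurable D -> mu.-integrable D (EFin \o f) ->
  continuous (fun x => \int[mu]_(t in D) (kappa `|x - t| * f t)).
Proof.
move=> ck kM mD intf x.
apply: (@continuity_under_integral _ _ _ mu (fun x t => kappa `|x - t| * f t)
  D mD (x - 1) (x + 1) _ _ (fun t => M * `|f t|)) => //.
- by move=> y _; exact: (integrable_convolution y ck kM).
- apply: aeW => t _ y _; apply: cvgM; last exact: cvg_cst.
  apply: (@continuous_comp _ _ _ (fun y => `|y - t|) kappa); last exact: ck.
  by apply: cvg_norm; apply: cvgB; [exact: cvg_id|exact: cvg_cst].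
- have -> : EFin \o (fun t => M * `|f t|) =
      (fun t => M%:E * (EFin \o (fun t => `|f t|%R)) t)%E.
    by apply/funext => t; rewrite /= EFinM.
  by apply: integrableZl => //; exact: integrable_norm.
- by move=> y _; apply: aeW => t _; rewrite normrM ler_wpM2r// kM.
- rewrite inE/= in_itv/=.
  by apply/andP; split; [rewrite gtrDl oppr_lt0|rewrite ltrDl].
Qed.

(** An almost-everywhere linear relation becomes a relation at every point
    after convolution, because an integral ignores null sets. *)
Lemma convolution_ae_combination (kappa : R -> R) (M : R) (D : set R)
    f g h (s t x : R) :
  continuous kappa -> (forall y, 0 <= y -> `|kappa y| <= M) ->
  measurable D -> measurable_fun D f ->
  mu.-integrable D (EFin \o g) -> mu.-integrable D (EFin \o h) ->
  f = (fun y => s * g y + t * h y) %[ae mu in D] ->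
  \int[mu]_(y in D) (kappa `|x - y| * f y) =
  s * \int[mu]_(y in D) (kappa `|x - y| * g y) +
  t * \int[mu]_(y in D) (kappa `|x - y| * h y).
Proof.
move=> ck kM mD mf ig ih fE.
have ikg := integrable_convolution x ck kM mD ig.
have ikh := integrable_convolution x ck kM mD ih.
have isg : mu.-integrable D (EFin \o (fun y => s * (kappa `|x - y| * g y))).
  exact: (@integrableZl _ _ _ mu D mD s _ ikg).
have ith : mu.-integrable D (EFin \o (fun y => t * (kappa `|x - y| * h y))).
  exact: (@integrableZl _ _ _ mu D mD t _ ikh).
have kfE : (fun y => (kappa `|x - y| * f y)%:E) =
    (fun y => (s * (kappa `|x - y| * g y) + t * (kappa `|x - y| * h y))%:E)
    %[ae mu in D].
  apply: (@filterS _ _ (ae_filter_ringOfSetsType mu) _ _ _ fE) => y fy Dy.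
  by rewrite fy//; congr EFin; ring.
rewrite -!RintegralZl// -RintegralD//.
rewrite /Rintegral; congr fine; apply: ae_eq_integral => //.
- apply/measurable_EFinP; apply: measurable_funM => //.
  apply: measurable_funTS; apply: continuous_measurable_fun.
  exact: continuous_kernel_translate.
- apply/measurable_EFinP; apply: measurable_funD.
    by apply/measurable_EFinP; exact: measurable_int isg.
  by apply/measurable_EFinP; exact: measurable_int ith.
Qed.

(** On a set of finite measure [L^2] is contained in [L^1], since
    [|h| <= 1 + h^2]. *)
Lemma L2_integrable a b (u : R -> R[i]) : L2 `[a, b] u ->
  mu.-integrable `[a, b] (EFin \o (fun x => complex.Re (u x))) /\
  mu.-integrable `[a, b] (EFin \o (fun x => complex.Im (u x))).
Proof.
move=> [[mRe mIm] iu].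
have mI : measurable (`[a, b]%classic : set R) by [].
have i1 : mu.-integrable `[a, b] (EFin \o cst (1 : R)).
  by apply: continuous_integrable_itv => x; exact: cvg_cst.
have normcE x : ComplexField.Normc.normc (u x) ^+ 2 =
    complex.Re (u x) ^+ 2 + complex.Im (u x) ^+ 2.
  by case: (u x) => p q /=; rewrite sqr_sqrtr// addr_ge0 ?sqr_ge0.
have dom h : measurable_fun `[a, b] h ->
    (forall x, h x ^+ 2 <= ComplexField.Normc.normc (u x) ^+ 2) ->
    mu.-integrable `[a, b] (EFin \o h).
  move=> mh hu; apply: (@le_integrable _ _ _ mu _ mI _
    (fun x => 1%:E + (ComplexField.Normc.normc (u x) ^+ 2)%:E)%E).
  - exact/measurable_EFinP.
  - move=> x _; rewrite -EFinD lee_fin [leRHS]ger0_norm ?addr_ge0 ?sqr_ge0//.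
    rewrite (le_trans _ (lerD (lexx 1) (hu x)))//.
    have := sqr_ge0 (`|h x| - 1); rewrite -[h x ^+ 2]real_normK ?num_real//.
    by have := normr_ge0 (h x); nra.
  - exact: integrableD.
by split; apply: dom => // x; rewrite normcE ?lerDl ?lerDr sqr_ge0.
Qed.

(** * The damped kernel *)

Definition damped_kernel (a y : R) : R :=
  expR (- (a * y)) * (cos (a * y) + sin (a * y)).

Lemma continuous_damped_kernel a : continuous (damped_kernel a).
Proof.
have -> : damped_kernel a =
    fun y => expR (- a * y) * (cos (a * y) + sin (a * y)).
  by apply/funext => y; rewrite /damped_kernel mulNr.
move=> y.
have De := is_derive_comp_mull (is_derive_expR (- a * y)).
have Dc := is_derive_comp_mull (is_derive_cos (a * y)).
have Ds := is_derive_comp_mull (is_derive_sin (a * y)).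
exact: is_derive_continuous (is_derive_mulf De (is_derive_addf Dc Ds)).
Qed.

Lemma damped_kernel_le2 a y : 0 <= a * y -> `|damped_kernel a y| <= 2.
Proof.
move=> ay; rewrite /damped_kernel normrM ger0_norm ?expR_ge0//.
have e1 : expR (- (a * y)) <= 1 by rewrite -expR0 ler_expR oppr_le0.
have cs : `|cos (a * y) + sin (a * y)| <= 2.
  rewrite (le_trans (ler_normD _ _))// -[leRHS]/(1 + 1).
  by rewrite lerD// ler_norml ?cos_geN1 ?cos_le1 ?sin_geN1 ?sin_le1.
by rewrite -[leRHS]mul1r ler_pM// expR_ge0.
Qed.

Lemma alpha_gt0 (k E I : R) : 0 < k -> 0 < E -> 0 < I -> 0 < alpha k E I.
Proof. by move=> k0 E0 I0; rewrite powR_gt0// divr_gt0// mulr_gt0. Qed.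

Lemma sin_addr_piquarter y : sin (y + pi / 4) = (cos y + sin y) / Num.sqrt 2.
Proof.
have c0 : 0 < cos (pi / 4 : R).
  by apply: cos_gt0_pihalf; have := pi_gt0 R; lra.
have sc : sin (pi / 4 : R) = cos (pi / 4).
  apply/eqP; rewrite -[eqbRHS]mul1r -[X in _ == X * _](@tan_piquarter R).
  by rewrite /tan divfK// gt_eqF.
have c2 : cos (pi / 4 : R) = (Num.sqrt 2)^-1.
  apply/eqP; rewrite -(@eqrXn2 _ 2) ?invr_ge0 ?sqrtr_ge0 ?(ltW c0)//.
  rewrite exprVn sqr_sqrtr//; apply/eqP.
  by have := cos2Dsin2 (pi / 4 : R); rewrite sc; lra.
by rewrite sinD sc c2; ring.
Qed.

Lemma kernel_funE (k E I y : R) : kernel_fun k E I y =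
  alpha k E I / Num.sqrt 2 / (2 * k)
    * damped_kernel (alpha k E I / Num.sqrt 2) y.
Proof. by rewrite /kernel_fun /damped_kernel sin_addr_piquarter; ring. Qed.

(** * The boundary value problem solved by the convolution *)

(** [P] and [Q] are the integrals over [t] from [x0] to [x] of
    [exp (- b (x - t)) cos (b (x - t)) f(t)] and of its sine analogue.  The
    addition formulas separate [x] from [t], so that the derivatives of [P] and
    [Q], and an antiderivative [T] in [t] of the combined integrand for fixed
    [x], all come from two antiderivatives.  Taking [b = a] and [b = - a] gives
    the contributions of the load on the left and on the right of [x]. *)
Lemma exists_damped_integrals b m x0 f : continuous f -> m < x0 ->
  exists P Q : R -> R,
  [/\ P x0 = 0 /\ Q x0 = 0,
      forall x, m < x -> is_derive x 1 P (- b * P x - b * Q x + f x),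
      forall x, m < x -> is_derive x 1 Q (b * P x - b * Q x) &
      forall x, exists T : R -> R, [/\ T x0 = 0, T x = P x + Q x &
        forall y, m < y -> is_derive y 1 T
          (expR (- (b * (x - y))) * (cos (b * (x - y)) + sin (b * (x - y)))
           * f y)]].
Proof.
move=> cf mx0.
have De c x := is_derive_comp_mull (is_derive_expR (c * x)).
have Dc x := is_derive_comp_mull (is_derive_cos (b * x)).
have Ds x := is_derive_comp_mull (is_derive_sin (b * x)).
have [|C [C0 dC]] := @exists_antiderivative
    (fun t => expR (b * t) * cos (b * t) * f t) m x0.
  move=> t; apply: cvgM; last exact: cf.
  exact: is_derive_continuous (is_derive_mulf (De b t) (Dc t)).
have [|S [S0 dS]] := @exists_antiderivative
    (fun t => expR (b * t) * sin (b * t) * f t) m x0.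
  move=> t; apply: cvgM; last exact: cf.
  exact: is_derive_continuous (is_derive_mulf (De b t) (Ds t)).
have trig x : cos (b * x) ^+ 2 + sin (b * x) ^+ 2 = 1 by exact: cos2Dsin2.
have ee x : expR (- b * x) * expR (b * x) = 1.
  by rewrite -expRD mulNr addNr expR0.
exists (fun x => expR (- b * x) * (cos (b * x) * C x + sin (b * x) * S x)).
exists (fun x => expR (- b * x) * (sin (b * x) * C x - cos (b * x) * S x)).
split.
- by rewrite C0 S0 !mulr0 addr0 subr0 !mulr0.
- move=> x mx.
  have DC := is_derive_mulf (Dc x) (dC x mx).
  have DS := is_derive_mulf (Ds x) (dS x mx).
  apply: (is_derive_eq (is_derive_mulf (De (- b) x) (is_derive_addf DC DS))).
  (* isolate the two products that equal 1 *)
  transitivity (expR (- b * x) * (b * (- sin (b * x) * C x + cos (b * x) * S x)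
     - b * (cos (b * x) * C x + sin (b * x) * S x)) +
     (expR (- b * x) * expR (b * x)) * (cos (b * x) ^+ 2 + sin (b * x) ^+ 2)
       * f x); first by ring.
  by rewrite trig ee; ring.
- move=> x mx.
  have DC := is_derive_mulf (Ds x) (dC x mx).
  have DS := is_derive_mulf (Dc x) (dS x mx).
  apply: (is_derive_eq (is_derive_mulf (De (- b) x) (is_derive_subf DC DS))).
  by ring.
- move=> x.
  exists (fun y => expR (- b * x) * (cos (b * x) + sin (b * x)) * C y
    + expR (- b * x) * (sin (b * x) - cos (b * x)) * S y); split.
  + by rewrite C0 S0 !mulr0 addr0.
  + by ring.
  + move=> y my.
    apply: (is_derive_eq (is_derive_addf (is_derive_cmulf _ (dC y my))
      (is_derive_cmulf _ (dS y my)))).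
    have -> : - (b * (x - y)) = - b * x + b * y by ring.
    have -> : b * (x - y) = b * x - b * y by ring.
    by rewrite expRD cosB sinB; ring.
Qed.

(** The jet of a solution of [w'''' + 4 a^4 w = 8 a^3 f] with [w0 = w],
    [w1 = w' / (2 a)], [w2 = w'' / (2 a^2)] and [w3 = w''' / (4 a^3)].  The last
    four fields say that [w] continues beyond [l] and [-l] to solutions of the
    homogeneous equation that decay at infinity: to the right these satisfy
    [w'' + 2 a w' + 2 a^2 w = 0] and its derivative, to the left the same with
    [a] replaced by [- a]. *)
Record beam_jet (l a : R) (f w0 w1 w2 w3 : R -> R) : Prop := BeamJet {
  jet_d0 : forall x, - l <= x <= l -> is_derive x 1 w0 (2 * a * w1 x);
  jet_d1 : forall x, - l <= x <= l -> is_derive x 1 w1 (a * w2 x);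
  jet_d2 : forall x, - l <= x <= l -> is_derive x 1 w2 (2 * a * w3 x);
  jet_d3 : forall x, - l <= x <= l -> is_derive x 1 w3 (2 * f x - a * w0 x);
  jet_r2 : w2 l = - w0 l - 2 * w1 l;
  jet_r3 : w3 l = w0 l + w1 l;
  jet_l2 : w2 (- l) = - w0 (- l) + 2 * w1 (- l);
  jet_l3 : w3 (- l) = - w0 (- l) + w1 (- l) }.

(** Splitting the convolution at [x] gives [w0 = (P + Q) - (p + q)], where [P]
    and [Q] start from [-l] with rate [a], and [p] and [q] start from [l] with
    rate [- a]; the minus sign reverses the orientation of the second integral.
    In these terms the whole jet is linear, and the boundary conditions express
    that [p], [q] vanish at [l] and [P], [Q] at [-l]. *)
Lemma exists_beam_jet l a f : 0 < l -> continuous f ->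
  exists w0 w1 w2 w3, beam_jet l a f w0 w1 w2 w3 /\
    forall x, - l <= x <= l ->
      \int[mu]_(t in `[- l, l]) (damped_kernel a `|x - t| * f t) = w0 x.
Proof.
move=> l0 cf.
have ml : - l - 1 < l by lra.
have mNl : - l - 1 < - l by lra.
have [P [Q [[P0 Q0] dP dQ PQ]]] := exists_damped_integrals a cf mNl.
have [p [q [[p0 q0] dp dq pq]]] := exists_damped_integrals (- a) cf ml.
have lt_m x : - l <= x <= l -> - l - 1 < x by move=> /andP[? _]; lra.
exists (fun x => P x + Q x - (p x + q x)), (fun x => - (Q x + q x)),
  (fun x => Q x - P x - (q x - p x)), (fun x => P x + p x).
split; first split.
- move=> x /lt_m mx.
  apply: (is_derive_eq (is_derive_subf (is_derive_addf (dP x mx) (dQ x mx))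
    (is_derive_addf (dp x mx) (dq x mx)))).
  by ring.
- move=> x /lt_m mx.
  apply: (is_derive_eq (is_deriveN (is_derive_addf (dQ x mx) (dq x mx)))).
  by ring.
- move=> x /lt_m mx.
  apply: (is_derive_eq (is_derive_subf (is_derive_subf (dQ x mx) (dP x mx))
    (is_derive_subf (dq x mx) (dp x mx)))).
  by ring.
- move=> x /lt_m mx.
  by apply: (is_derive_eq (is_derive_addf (dP x mx) (dp x mx))); ring.
- by rewrite p0 q0; ring.
- by rewrite p0 q0; ring.
- by rewrite P0 Q0; ring.
- by rewrite P0 Q0; ring.
move=> x lxl.
have cdk : continuous (fun t : R => damped_kernel a `|x - t| * f t).
  move=> t; apply: cvgM; last exact: cf.
  exact/continuous_kernel_translate/continuous_damped_kernel.
rewrite (Rintegral_split lxl cdk).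
have [T [T0 Tx dT]] := PQ x.
have [S [S0 Sx dS]] := pq x.
have /andP[lx xl] := lxl.
have {}dT t : - l <= t <= x ->
    is_derive t 1 T (damped_kernel a `|x - t| * f t).
  move=> /andP[lt tx].
  have mt : - l - 1 < t by lra.
  apply: (is_derive_eq (dT t mt)).
  by rewrite /damped_kernel ger0_norm// subr_ge0.
have {}dS t : x <= t <= l ->
    is_derive t 1 S (damped_kernel a `|x - t| * f t).
  move=> /andP[xt tl].
  have mt : - l - 1 < t by lra.
  apply: (is_derive_eq (dS t mt)).
  have -> : - a * (x - t) = a * (t - x) by ring.
  by rewrite /damped_kernel distrC ger0_norm// subr_ge0.
rewrite (Rintegral_FTC2 lx cdk dT) (Rintegral_FTC2 xl cdk dS).
by rewrite T0 S0 Tx Sx; ring.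
Qed.

(** * The Green form and the eigenvalues *)

(** Up to the factor [4 a^3] the function is [w''' z - w'' z'], chosen so that
    the terms [w''' z'] cancel in its derivative. *)
Lemma is_derive_green_form l a f w0 w1 w2 w3 g z0 z1 z2 z3 :
  beam_jet l a f w0 w1 w2 w3 -> beam_jet l a g z0 z1 z2 z3 ->
  forall x, - l <= x <= l ->
    is_derive x 1 (fun t => w3 t * z0 t - w2 t * z1 t)
      (2 * (f x * z0 x) - a * (w0 x * z0 x + w2 x * z2 x)).
Proof.
move=> [dw0 dw1 dw2 dw3 _ _ _ _] [dz0 dz1 dz2 dz3 _ _ _ _] x lxl.
apply: (is_derive_eq (is_derive_subf (is_derive_mulf (dw3 x lxl) (dz0 x lxl))
  (is_derive_mulf (dw2 x lxl) (dz1 x lxl)))).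
by ring.
Qed.

Lemma jet_eq0 l a f w0 w1 w2 w3 : beam_jet l a f w0 w1 w2 w3 ->
  (forall x, - l < x < l -> w2 x = 0) ->
  w0 l = 0 -> w1 l = 0 -> forall x, - l <= x <= l -> w0 x = 0.
Proof.
move=> [dw0 dw1 _ _ _ _ _ _] w20 w0l w1l.
have w10 x : - l <= x <= l -> w1 x = 0.
  move=> lxl; rewrite -w1l.
  apply: (derivative_eq0_constant dw1) lxl => t lt.
  by rewrite w20// mulr0.
move=> x lxl; rewrite -w0l.
apply: (derivative_eq0_constant dw0) lxl => t /andP[lt tl].
by rewrite w10 ?mulr0// !ltW.
Qed.

(** The hypotheses on [a * w0] and [a * z0] are the real and imaginary parts of
    the eigenvalue equation for [f + i g] and [s + i t], the convolution operator
    being [a / (2 k)] times the map from the load to [w0]. *)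
Lemma jet_eigenvalue l a (k s t : R) f w0 w1 w2 w3 g z0 z1 z2 z3 y :
  0 < a -> 0 < k -> s ^+ 2 + t ^+ 2 != 0 ->
  beam_jet l a f w0 w1 w2 w3 -> beam_jet l a g z0 z1 z2 z3 ->
  (forall x, - l <= x <= l -> a * w0 x = 2 * k * (s * f x - t * g x)) ->
  (forall x, - l <= x <= l -> a * z0 x = 2 * k * (s * g x + t * f x)) ->
  - l < y < l -> f y ^+ 2 + g y ^+ 2 != 0 ->
  t = 0 /\ 0 < s < 1 / k.
Proof.
move=> a0 k0 st0 jw jz ew ez yl fgy.
have jww := is_derive_green_form jw jw.
have jzz := is_derive_green_form jz jz.
have jwz := is_derive_green_form jw jz.
have jzw := is_derive_green_form jz jw.
have [_ _ _ _ rw2 rw3 lw2 lw3] := jw.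
have [_ _ _ _ rz2 rz3 lz2 lz3] := jz.
have a_neq0 : a != 0 by rewrite gt_eqF.
have {}ew x : - l <= x <= l -> w0 x = 2 * k / a * (s * f x - t * g x).
  by move=> /ew H; field: H.
have {}ez x : - l <= x <= l -> z0 x = 2 * k / a * (s * g x + t * f x).
  by move=> /ez H; field: H.
pose N x := f x ^+ 2 + g x ^+ 2.
change (is_true (N y != 0)) in fgy.
have N0 x : 0 <= N x by rewrite addr_ge0// sqr_ge0.
have [yl1 yl2] := andP yl.
have yI : - l <= y <= l by rewrite !ltW.
have lI : - l <= l by lra.
have ka0 : 0 < 4 * k / a by rewrite divr_gt0// mulr_gt0.
have t0 : t = 0.
  (* the factor - t turns the derivative, a multiple of t, into minus a square *)
  pose F x := - t * ((w3 x * z0 x - w2 x * z1 x) - (z3 x * w0 x - z2 x * w1 x)).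
  have dF x : - l <= x <= l ->
      is_derive x 1 F (- (4 * k / a * (t ^+ 2 * N x))).
    move=> lxl; apply: (is_derive_eq (is_derive_cmulf _
      (is_derive_subf (jwz x lxl) (jzw x lxl)))).
    by rewrite (ew x lxl) (ez x lxl) /N; field.
  have F0 x : - l <= x <= l -> - (4 * k / a * (t ^+ 2 * N x)) <= 0.
    by move=> _; rewrite oppr_le0 (mulr_ge0 (ltW ka0))// mulr_ge0// sqr_ge0.
  have /eqP : - (4 * k / a * (t ^+ 2 * N y)) = 0.
    apply: (nonincreasing_eq_ends_derivative0 dF F0) yl.
    rewrite /F rw2 rw3 lw2 lw3 rz2 rz3 lz2 lz3 le_eqVlt.
    by apply/orP; left; apply/eqP; ring.
  rewrite oppr_eq0 mulf_eq0 (gt_eqF ka0) mulf_eq0 (negbTE fgy) orbF.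
  by rewrite sqrf_eq0 => /eqP.
split => //; subst t.
have sk : k * s ^+ 2 < s.
  rewrite ltNge; apply/negP => sk.
  pose F x := (w3 x * w0 x - w2 x * w1 x) + (z3 x * z0 x - z2 x * z1 x).
  pose dF x := - (4 * k / a * ((k * s ^+ 2 - s) * N x)
                  + a * (w2 x ^+ 2 + z2 x ^+ 2)).
  have dFE x : - l <= x <= l -> is_derive x 1 F (dF x).
    move=> lxl; apply: (is_derive_eq (is_derive_addf (jww x lxl) (jzz x lxl))).
    by rewrite (ew x lxl) (ez x lxl) /dF /N; field.
  have c1 x : 0 <= 4 * k / a * ((k * s ^+ 2 - s) * N x).
    by rewrite (mulr_ge0 (ltW ka0))// mulr_ge0// subr_ge0.
  have c2 x : 0 <= a * (w2 x ^+ 2 + z2 x ^+ 2).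
    by rewrite (mulr_ge0 (ltW a0))// addr_ge0// sqr_ge0.
  have Fl : F l =
      (w0 l + w1 l) ^+ 2 + w1 l ^+ 2 + (z0 l + z1 l) ^+ 2 + z1 l ^+ 2.
    by rewrite /F rw2 rw3 rz2 rz3; ring.
  have FNl : F (- l) = - ((w0 (- l) - w1 (- l)) ^+ 2 + w1 (- l) ^+ 2
      + (z0 (- l) - z1 (- l)) ^+ 2 + z1 (- l) ^+ 2).
    by rewrite /F lw2 lw3 lz2 lz3; ring.
  have FNl0 : F (- l) <= 0 by rewrite FNl oppr_le0 !addr_ge0// sqr_ge0.
  have Fl0 : 0 <= F l by rewrite Fl !addr_ge0// sqr_ge0.
  have dF0 x : - l < x < l -> dF x = 0.
    apply: (nonincreasing_eq_ends_derivative0 dFE).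
      by move=> z _; rewrite oppr_le0 addr_ge0.
    exact: le_trans FNl0 Fl0.
  have Fc : F (- l) = F l.
    by apply: (derivative_eq0_constant dFE dF0); rewrite lexx.
  have {FNl0}Fl0 : F l = 0 by lra.
  have w20 x : - l < x < l -> w2 x ^+ 2 + z2 x ^+ 2 = 0.
    move=> /dF0/eqP; rewrite oppr_eq0 paddr_eq0// => /andP[_].
    by rewrite mulf_eq0 (negbTE a_neq0) => /eqP.
  have w2z x : - l < x < l -> w2 x = 0.
    by move=> /w20/eqP; rewrite paddr_eq0 ?sqr_ge0// !sqrf_eq0 => /andP[/eqP].
  have z2z x : - l < x < l -> z2 x = 0.
    by move=> /w20/eqP; rewrite paddr_eq0 ?sqr_ge0// !sqrf_eq0 => /andP[_ /eqP].
  move: Fl0; rewrite Fl => /eqP.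
  rewrite !paddr_eq0 ?addr_ge0 ?sqr_ge0// !sqrf_eq0 -!andbA.
  move=> /and4P[/eqP + /eqP w1l /eqP + /eqP z1l].
  rewrite w1l z1l !addr0 => w0l z0l.
  have w00 := jet_eq0 jw w2z w0l w1l yI.
  have z00 := jet_eq0 jz z2z z0l z1l yI.
  have : (s ^+ 2 + 0 ^+ 2) * N y =
      (a / (2 * k)) ^+ 2 * (w0 y ^+ 2 + z0 y ^+ 2).
    by rewrite ew// ez// /N; field; rewrite a_neq0 gt_eqF.
  have -> : w0 y ^+ 2 + z0 y ^+ 2 = 0 by rewrite w00 z00; ring.
  by rewrite mulr0 => /eqP; rewrite mulf_eq0 (negbTE fgy) (negbTE st0).
have s0 : 0 < s by rewrite (le_lt_trans _ sk)// mulr_ge0 ?sqr_ge0// ltW.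
by rewrite s0/= ltr_pdivlMr// -(ltr_pM2l s0) mulr1 mulrA mulrC -expr2.
Qed.

End BeamSpectrum.

Local Open Scope complex_scope.

Theorem theorem1 (R : realType) (l k E I : R)
    (hl : 0 < l) (hk : 0 < k) (hE : 0 < E) (hI : 0 < I)
    (lam : R[i])
    (hlam : is_eigenvalue `[- l, l] (Kop l k E I) lam)
    (hlam0 : lam <> 0) :
  complex.Im lam = 0 /\ 0 < complex.Re lam < 1 / k.
Proof.
pose mu := @lebesgue_measure R.
case: hlam => u [Lu u_neq0 Ku].
have [iu1 iu2] := L2_integrable Lu.
set D := [set` `[- l, l]] in iu1 iu2 u_neq0 Ku.
have mD : measurable D by exact: measurable_itv.
pose a := alpha k E I / Num.sqrt 2.
have a0 : 0 < a by rewrite divr_gt0 ?alpha_gt0 ?sqrtr_gt0.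
pose kappa := kernel_fun k E I.
have kappaE y : kappa y = a / (2 * k) * damped_kernel a y.
  exact: kernel_funE.
have ck : continuous kappa.
  rewrite (_ : kappa = fun y => a / (2 * k) * damped_kernel a y).
    by move=> y; apply: cvgM; [exact: cvg_cst|exact: continuous_damped_kernel].
  exact/funext.
have c0 : 0 < a / (2 * k) by apply: (divr_gt0 a0); apply: mulr_gt0.
have kM y : 0 <= y -> `|kappa y| <= a / (2 * k) * 2.
  move=> y0; rewrite kappaE normrM gtr0_norm// ler_wpM2l ?(ltW c0)//.
  by apply: damped_kernel_le2; rewrite mulr_ge0 ?(ltW a0).
pose A (h : R -> R) x := \int[mu]_(y in D) (kappa `|x - y| * h y).
(* f + i g is the image of u: unlike u it is continuous, and it satisfies the
   eigenvalue equation at every point *)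
pose f := A (fun x => complex.Re (u x)).
pose g := A (fun x => complex.Im (u x)).
have cf : continuous f by exact: (continuous_convolution ck kM mD iu1).
have cg : continuous g by exact: (continuous_convolution ck kM mD iu2).
have KE x : Kop l k E I u x = f x +i* g x.
  rewrite /Kop /cintegral; congr (_ +i* _); apply: eq_Rintegral => y _ /=.
    by case: (u y) => p q /=; rewrite mul0r subr0.
  by case: (u y) => p q /=; rewrite mul0r addr0.
case: lam hlam0 Ku => s t st0 Ku.
have st_neq0 : s ^+ 2 + t ^+ 2 != 0.
  apply/eqP => /eqP; rewrite paddr_eq0 ?sqr_ge0// !sqrf_eq0.
  by move=> /andP[/eqP s0 /eqP t0]; apply: st0; rewrite s0 t0.
have aeF := ae_filter_ringOfSetsType mu.
have fE : f = (fun x => s * complex.Re (u x) + - t * complex.Im (u x))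
    %[ae mu in D].
  apply: (@filterS _ _ aeF _ _ _ Ku) => x + Dx => /(_ Dx); rewrite KE.
  by case: (u x) => p q [-> _] /=; rewrite mulNr.
have gE : g = (fun x => s * complex.Im (u x) + t * complex.Re (u x))
    %[ae mu in D].
  apply: (@filterS _ _ aeF _ _ _ Ku) => x + Dx => /(_ Dx); rewrite KE.
  by case: (u x) => p q [_ ->].
have Af x : A f x = s * f x - t * g x.
  rewrite /A (convolution_ae_combination _ ck kM mD _ iu1 iu2 fE) ?mulNr//.
  exact: (measurable_funTS (continuous_measurable_fun cf)).
have Ag x : A g x = s * g x + t * f x.
  rewrite /A (convolution_ae_combination _ ck kM mD _ iu2 iu1 gE)//.
  exact: (measurable_funTS (continuous_measurable_fun cg)).
have [w0 [w1 [w2 [w3 [jw wE]]]]] := exists_beam_jet a hl cf.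
have [z0 [z1 [z2 [z3 [jz zE]]]]] := exists_beam_jet a hl cg.
have AE (h : R -> R) x : continuous h -> A h x =
    a / (2 * k) * \int[mu]_(y in D) (damped_kernel a `|x - y| * h y).
  move=> ch; rewrite -RintegralZl//; last first.
    apply: (@integrable_convolution _ _ 2 _ _ _ _ _ mD).
    - exact: continuous_damped_kernel.
    - by move=> y y0; apply: damped_kernel_le2; apply: mulr_ge0 => //; exact: ltW.
    - exact: continuous_integrable_itv.
  by apply: eq_Rintegral => y _; rewrite kappaE mulrA.
have [y [yl fgy]] : exists y, - l < y < l /\ f y ^+ 2 + g y ^+ 2 != 0.
  apply: contrapT => nex; apply: u_neq0.
  have ae_neq z : \forall x \ae mu, x <> z.
    exists [set z]; split; first exact: measurable_set1.
      exact: lebesgue_measure_set1.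
    by move=> x /= /contrapT.
  apply: (@filterS3 _ _ aeF _ _ _ _ _ Ku (ae_neq l) (ae_neq (- l))).
  move=> x Kux xl xNl Dx; move: (Kux Dx).
  have fg0 : f x ^+ 2 + g x ^+ 2 = 0.
    apply/eqP; apply: contrapT => fg0; apply: nex.
    exists x; split; last exact/negP.
    move: Dx; rewrite /D/= in_itv/= => /andP[lx xl'].
    rewrite !lt_neqAle lx xl' !andbT.
    by apply/andP; split; apply/eqP => // /esym.
  move/eqP : fg0; rewrite paddr_eq0 ?sqr_ge0// !sqrf_eq0.
  move=> /andP[/eqP f0 /eqP g0].
  rewrite KE f0 g0 => /esym/eqP; rewrite mulf_eq0 => /orP[/eqP|/eqP//].
  by move=> lam0; exfalso; exact: st0.
apply: (jet_eigenvalue a0 hk st_neq0 jw jz _ _ yl fgy).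
- by move=> x lxl; rewrite -wE// -Af AE//; field; rewrite !gt_eqF.
- by move=> x lxl; rewrite -zE// -Ag AE//; field; rewrite !gt_eqF.
Qed.
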